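(* For every $n\ge 1$, $|\mathcal{DRS}_n(213)|=S_n$, where $S_n$ is the number of Motzkin paths of length $n$ with no two consecutive up steps.
   Context: For $\sigma\in\mathfrak{S}_n$, a double descent is an index $i$ with $\sigma_i>\sigma_{i+1}>\sigma_{i+2}$. The permutation $\sigma$ is simsun if for every $k$, the subword of $\sigma$ consisting of the letters in $\{1,\dots,k\}$ (in the order they appear in $\sigma$) has no double descent. For $\omega\in\mathfrak{S}_t$, $\sigma$ contains an $\omega$-pattern if there are indices $i_1<\cdots<i_t$ with $\sigma_{i_j}<\sigma_{i_k}$ iff $\omega_j<\omega_k$; otherwise $\sigma$ is $\omega$-avoiding. $\mathcal{DRS}_n(\omega)$ is the set of $\sigma\in\mathfrak{S}_n$ such that $\sigma$ is $\omega$-avoiding and simsun and $\sigma^{-1}$ is simsun ($\sigma^{-1}$ need not avoid $\omega$). A Motzkin path of length $n$ is a lattice path from $(0,0)$ to $(n,0)$ with up steps $(1,1)$, down steps $(1,-1)$ and level steps $(1,0)$ never going below the $x$-axis. ($S_n$ is the secondary structure number: $1,1,2,4,8,17,\dots$ for $n=1,2,3,\dots$.) *)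

(* Defs.v *)
From HB Require Import structures.
From mathcomp Require Import all_boot all_order all_algebra all_fingroup.

Set Implicit Arguments.
Unset Strict Implicit.
Unset Printing Implicit Defensive.

Import Order.TTheory GRing.Theory Num.Theory.

(* Permutations of {1, ..., n} are encoded as 'S_n, i.e. positions and letters
   are both shifted down by one: letter v + 1 is represented by v. *)

Definition perm_word (n : nat) (s : 'S_n) : seq nat :=
  [seq val (s i) | i <- enum 'I_n].

Definition double_descent (w : seq nat) (i : nat) : bool :=
  [&& i.+2 < size w, nth 0 w i > nth 0 w i.+1 & nth 0 w i.+1 > nth 0 w i.+2].

Definition has_double_descent (w : seq nat) : bool :=
  [exists i : 'I_(size w), double_descent w i].

(* The letters {1, ..., k} are the values < k after the shift; k > n would give
   the same subword as k = n. *)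
Definition simsun (n : nat) (s : 'S_n) : bool :=
  [forall k : 'I_n.+1, ~~ has_double_descent [seq v <- perm_word s | v < k]].

Definition contains_pattern (t n : nat) (w : 'S_t) (s : 'S_n) : bool :=
  [exists i : {ffun 'I_t -> 'I_n},
    [forall j : 'I_t, forall k : 'I_t, (j < k) ==> (i j < i k)] &&
    [forall j : 'I_t, forall k : 'I_t, (s (i j) < s (i k)) == (w j < w k)]].

Definition avoids (t n : nat) (w : 'S_t) (s : 'S_n) : bool :=
  ~~ contains_pattern w s.

Definition DRS (t n : nat) (w : 'S_t) : {set 'S_n} :=
  [set s : 'S_n | [&& avoids w s, simsun s & simsun (s^-1)%g]].

(* The word 213 swaps the first two letters and fixes the third. *)
Definition pat213 : 'S_3 := tperm (inord 0) (inord 1).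

Lemma perm_word_pat213 : perm_word pat213 = [:: 1; 0; 2].
Proof.
rewrite /perm_word !enum_ordSl enum_ord0 /= !permE /=.
by rewrite -!val_eqE /= !inordK.
Qed.

Inductive step : Set := Up | Down | Level.

Definition ord_of_step (x : step) : 'I_3 :=
  match x with Up => inord 0 | Down => inord 1 | Level => inord 2 end.

Definition step_of_ord (i : 'I_3) : step :=
  match val i with 0 => Up | 1 => Down | _ => Level end.

Lemma ord_of_stepK : cancel ord_of_step step_of_ord.
Proof. by case; rewrite /step_of_ord /= inordK. Qed.

HB.instance Definition _ := Finite.copy step (can_type ord_of_stepK).

Definition rise (x : step) : int :=
  match x with Up => 1%R | Down => (-1)%R | Level => 0%R end.

Definition height (p : seq step) : int := (\sum_(x <- p) rise x)%R.

(* A lattice path from (0,0) with unit horizontal steps is determined by its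
   sequence of steps; after k steps it is at (k, height (take k p)). *)
Definition motzkin (n : nat) (p : n.-tuple step) : bool :=
  [forall k : 'I_n.+1, (0 <= height (take k p))%R] && (height p == 0%R).

Definition motzkin_noUU (n : nat) : {set n.-tuple step} :=
  [set p : n.-tuple step | motzkin p & ~~ infix [:: Up; Up] p].

Definition secondary_structure_number (n : nat) : nat := #|motzkin_noUU n|.

(* Main.v *)
(* Splitting a 213-avoiding permutation at its letter 1 as A 1 B forces every
   letter of A to exceed every letter of B, so 213-avoiders are binary trees; the
   inverse is the position of 1 followed by the inverses of B and of A.  In such
   words a double descent can only appear inside a block or where two blocks
   meet, so "simsun" and "simsun inverse" become local conditions on the tree.
   A Motzkin path without UU is uniquely empty, L p, UD p or U L p D q, and this
   grammar matches that of the trees meeting both conditions. *)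
Require Import Defs.
From mathcomp Require Import all_boot all_order all_algebra all_fingroup.
From mathcomp Require Import zify.

Set Implicit Arguments.
Unset Strict Implicit.
Unset Printing Implicit Defensive.

(** * Binary trees and the words they encode *)

Inductive tree := Lf | Nd (A B : tree).

Fixpoint tsize t := if t is Nd A B then (tsize A + tsize B).+1 else 0.

(* Both words are written with entries shifted by the offset [o], so that the
   blocks of a node need no renumbering. *)
Fixpoint tword t o :=
  if t is Nd A B then tword A (o + (tsize B).+1) ++ o :: tword B o.+1 else [::].

Fixpoint tinv t o :=
  if t is Nd A B then
    o + tsize A :: tinv B (o + tsize A).+1 ++ tinv A o
  else [::].

Lemma size_tword t o : size (tword t o) = tsize t.
Proof. by elim: t o => //= A IA B IB o; rewrite size_cat /= IA IB addnS. Qed.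

Lemma size_tinv t o : size (tinv t o) = tsize t.
Proof. by elim: t o => //= A IA B IB o; rewrite size_cat IA IB addnC. Qed.

Lemma perm_tword t o : perm_eq (tword t o) (iota o (tsize t)).
Proof.
elim: t o => //= A IA B IB o.
rewrite perm_catC /= perm_cons [tsize A + _]addnC iotaD.
by rewrite (_ : o.+1 + _ = o + (tsize B).+1) ?perm_cat //; lia.
Qed.

Lemma perm_tinv t o : perm_eq (tinv t o) (iota o (tsize t)).
Proof.
elim: t o => [|A IA B IB] o //.
rewrite [tsize _]/= -addnS iotaD [tinv _ _]/= -cat_cons perm_catC.
by rewrite perm_cat //= perm_cons.
Qed.

Lemma mem_tword t o x : (x \in tword t o) = (o <= x < o + tsize t).
Proof. by rewrite (perm_mem (perm_tword t o)) mem_iota. Qed.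

Lemma mem_tinv t o x : (x \in tinv t o) = (o <= x < o + tsize t).
Proof. by rewrite (perm_mem (perm_tinv t o)) mem_iota. Qed.

Lemma nth_tword t o i : i < tsize t -> o <= nth 0 (tword t o) i < o + tsize t.
Proof. by move=> it; rewrite -mem_tword mem_nth // size_tword. Qed.

(** This identifies [tinv t] as the inverse of [tword t]. Letters and positions carry independent
    offsets [o] and [p], because descending into a subtree shifts them differently. A letter of [A]
    exceeds the root and all of [B], so its index in [tinv] skips those two blocks. *)
Lemma nth_tinv_tword t o p i : i < tsize t ->
  nth 0 (tinv t p) (nth 0 (tword t o) i - o) = p + i.
Proof.
elim: t o p i => //= A IA B IB o p i lti.
rewrite nth_cat size_tword; case: ltnP => [iA | Ai].
  have := nth_tword (o + (tsize B).+1) iA; have := IA (o + (tsize B).+1) p i iA.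
  set v := nth 0 _ i => <- /andP[v1 v2].
  have -> : v - o = (tsize B + (v - (o + (tsize B).+1))).+1 by lia.
  by rewrite /= nth_cat size_tinv ltnNge leq_addr /= addKn.
case Ei: (i - tsize A) => [|j] /=; first by rewrite subnn /=; lia.
have jB : j < tsize B by lia.
have := nth_tword o.+1 jB; have := IB o.+1 (p + tsize A).+1 j jB.
set v := nth 0 _ j => IBj /andP[v1 v2].
have -> : v - o = (v - o.+1).+1 by lia.
by rewrite /= nth_cat size_tinv ifT ?IBj; lia.
Qed.

(** The position of the minimal letter [o] is the size of the left subtree, so the word determines
    where to cut. *)
Lemma tword_inj o t u : tword t o = tword u o -> t = u.
Proof.
elim: t u o => [|A IA B IB] [|A' B'] //= o => [/esym||].
- by case: (tword _ _).
- by case: (tword _ _).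
move=> E.
have io (X Y : tree) :
    index o (tword X (o + (tsize Y).+1) ++ o :: tword Y o.+1) = tsize X.
  rewrite index_cat mem_tword /= eqxx size_tword addn0.
  by rewrite (_ : (_ <= o) = false) //; lia.
have EA : tsize A = tsize A' by rewrite -(io A B) E io.
move/eqP: E; rewrite eqseq_cat ?size_tword // => /andP[/eqP E1 /eqP[E2]].
have EB := IB _ _ E2; rewrite EB in E1 *.
by rewrite (IA _ _ E1).
Qed.

(** * 213-avoiding words are exactly the words of trees *)

Fixpoint av213 w :=
  if w is x :: w' then
    pairwise (fun y z => ~~ (y < x < z)) w' && av213 w'
  else true.

Lemma av213P w :
  reflect (forall i j k, i < j -> j < k -> k < size w ->
             ~~ (nth 0 w j < nth 0 w i < nth 0 w k)) (av213 w).
Proof.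
elim: w => [|x w IH] /=; first by apply: ReflectT.
apply: (iffP andP) => [[/(pairwiseP 0) xw /IH avw] [|i] [|j] [|k] //= | avw].
- by rewrite !ltnS => _ jk kw; apply: xw => //; rewrite inE (ltn_trans jk).
- exact: (avw i j k).
split; last by apply/IH => i j k ij jk kw; apply: (avw i.+1 j.+1 k.+1).
by apply/(pairwiseP 0) => j k jw kw jk; apply: (avw 0 j.+1 k.+1).
Qed.

(** A pattern straddling the cut would start in [v] and have its largest letter in [w], below all of
    [v]. *)
Lemma av213_cat (v w : seq nat) :
  {in v & w, forall x y, y < x} -> av213 (v ++ w) = av213 v && av213 w.
Proof.
elim: v => //= x v IH vw; rewrite IH => [|y z yv zw]; last first.
  by apply: vw => //; rewrite inE yv orbT.
have xw z : z \in w -> (x < z) = false.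
  by move=> zw; have := vw x z; rewrite inE eqxx zw => /(_ isT isT); lia.
rewrite pairwise_cat (_ : allrel _ v w) /=; last first.
  by apply/allrelP => y z _ zw; rewrite xw // andbF.
rewrite (_ : pairwise _ w) ?andbT ?andbA //.
apply/(pairwiseP 0) => i j _ jw _.
by rewrite (xw (nth 0 w j)) ?andbF // mem_nth.
Qed.

Lemma av213_tword t o : av213 (tword t o).
Proof.
elim: t o => //= A IA B IB o.
rewrite av213_cat /= ?IA ?IB ?andbT => [|x y]; last first.
  rewrite mem_tword inE mem_tword => /andP[? ?] /orP[/eqP ->|/andP[? ?]]; lia.
apply/(pairwiseP 0) => i j; rewrite inE size_tword => iB _ _.
by have /andP[lti _] := nth_tword o.+1 iB; rewrite ltnNge ltnW.
Qed.

(** Strong induction on the length, cutting at the minimal letter [o]. The two sides must be shown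
    to fill consecutive intervals before the induction hypothesis applies to them. *)
Lemma av213_treeP w o n : perm_eq w (iota o n) -> av213 w ->
  exists2 t, tsize t = n & tword t o = w.
Proof.
have [m] := ubnP n; elim: m w o n => // m IH w o [|n].
  by move=> _ /perm_nilP -> _; exists Lf.
rewrite ltnS => nm wP.
have wo : o \in w by rewrite (perm_mem wP) inE eqxx.
case/splitPr: wo wP => v {}w wP.
rewrite [iota _ _]/= perm_catC /= perm_cons in wP => avw.
have ow x : x \in w ++ v -> o < x by rewrite (perm_mem wP) mem_iota => /andP[].
(* Otherwise [x], [o], [y] would form a 213-pattern. *)
have wv x y : x \in v -> y \in w -> y < x.
  move=> xv yw; have ox : o < x by rewrite ow // mem_cat xv orbT.
  have yx : y != x.
    have /= := perm_uniq wP; rewrite iota_uniq cat_uniq.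
    by case/and3P=> _ /hasPn/(_ _ xv) xw _; apply: contraNneq xw => <-.
  rewrite ltn_neqAle yx /= leqNgt.
  case/splitPr: xv avw {ow wP} => v1 v2.
  elim: v1 => [|z v1 IHv] /= /andP[+ av] //; last by move=> _; apply: IHv.
  rewrite pairwise_cat => /andP[_ /andP[_ /=]] /andP[/allP/(_ _ yw) + _].
  by rewrite ox.
(* As [w] lies below [v], sorting the two separately sorts the whole; cutting the interval at
   [size w] then gives the letters of each side. *)
have wvs : sort leq w ++ sort leq v = iota o.+1 n.
  apply: (sorted_eq leq_trans anti_leq); first last.
  - apply: perm_trans wP; apply: perm_cat; exact: permEl (perm_sort _ _).
  - exact: iota_sorted.
  rewrite sorted_pairwise; last exact: leq_trans.
  rewrite pairwise_cat -!(sorted_pairwise leq_trans) !sort_sorted ?andbT;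
    try exact: leq_total.
  by apply/allrelP => x y; rewrite !mem_sort => xw yv; apply/ltnW/wv.
have nE : n = size w + size v by rewrite -(size_iota o.+1 n) -wvs size_cat !size_sort.
move/eqP: wvs; rewrite nE iotaD eqseq_cat; last by rewrite size_sort size_iota.
case/andP=> /eqP sw /eqP sv.
have wE : perm_eq w (iota o.+1 (size w)) by rewrite -sw perm_sym perm_sort.
have vE : perm_eq v (iota (o.+1 + size w) (size v)).
  by rewrite -sv perm_sym perm_sort.
have /andP[avv avow] : av213 v && av213 (o :: w).
  rewrite -av213_cat // => x y xv; rewrite inE => /predU1P[->|]; last exact: wv.
  by rewrite ow // mem_cat xv orbT.
have [||B sB wB] := IH _ _ _ _ wE.
- by rewrite (leq_ltn_trans _ nm) // nE leq_addr.
- by case/andP: avow.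
have [||A sA wA] := IH _ _ _ _ vE => //.
  by rewrite (leq_ltn_trans _ nm) // nE leq_addl.
exists (Nd A B); first by rewrite /= sA sB addnC.
by rewrite /= sB addnS -addSn wA wB.
Qed.

(** * Double descents read by an automaton *)

(* [d] tells whether the letter [x] just read ended a descent; the start state
   [false], [0] is neutral since no letter is below [0]. *)
Fixpoint ddfree (d : bool) x w :=
  if w is y :: w' then ~~ (d && (y < x)) && ddfree (y < x) y w' else true.

Fixpoint end_desc (d : bool) x w :=
  if w is y :: w' then end_desc (y < x) y w' else d.

Lemma ddfree_cat d x v w :
  ddfree d x (v ++ w) = ddfree d x v && ddfree (end_desc d x v) (last x v) w.
Proof. by elim: v d x => //= y v IH d x; rewrite IH andbA. Qed.

Lemma end_desc_cat d x v w :
  end_desc d x (v ++ w) = end_desc (end_desc d x v) (last x v) w.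
Proof. by elim: v d x => //=. Qed.

Lemma ddfree_ge d x w : all (leq x) w -> ddfree d x w = ddfree false 0 w.
Proof. by case: w => //= y w /andP[xy _]; rewrite ltnNge xy andbF. Qed.

Lemma end_desc_ge d x w : all (leq x) w ->
  end_desc d x w = if nilp w then d else end_desc false 0 w.
Proof. by case: w => //= y w /andP[xy _]; rewrite ltnNge xy. Qed.

Lemma double_descentP w :
  reflect (exists i, double_descent w i) (has_double_descent w).
Proof.
apply: (iffP existsP) => [[i wi] | [i wi]]; first by exists i.
have iw : i < size w by case/and3P: wi => iw _ _; lia.
by exists (Ordinal iw).
Qed.

Lemma has_double_descent_cons x w :
  has_double_descent (x :: w) =
    [&& 1 < size w, nth 0 w 0 < x & nth 0 w 1 < nth 0 w 0]
    || has_double_descent w.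
Proof.
apply/double_descentP/orP => [[[|i] wi] | [wi | /double_descentP[i wi]]].
- by left.
- by right; apply/double_descentP; exists i.
- by exists 0.
by exists i.+1.
Qed.

Lemma ddfreeE w : ddfree false 0 w = ~~ has_double_descent w.
Proof.
(* Generalized to any state: a double descent may also be completed by the first letter of [w]. *)
have gen d x : ddfree d x w =
    ~~ [&& d, 0 < size w & nth 0 w 0 < x] && ~~ has_double_descent (x :: w).
  elim: w d x => [|y w IH] d x.
    by rewrite andbF; apply/esym/double_descentP => -[].
  rewrite /= IH (has_double_descent_cons x) ltnS /=.
  by do 2!case: (_ < _) => //=; case: (_ < _); case: d.
by rewrite gen /= has_double_descent_cons ltn0 andbF.
Qed.

(** * Restrictions to small letters, and descents at block boundaries *)

Definition below k w := [seq v <- w | v < k].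

Lemma below_cat k v w : below k (v ++ w) = below k v ++ below k w.
Proof. exact: filter_cat. Qed.

Lemma mem_below k w x : (x \in below k w) = (x < k) && (x \in w).
Proof. exact: mem_filter. Qed.

Lemma below_small k w : {in w, forall x, k <= x} -> below k w = [::].
Proof.
move=> kw; apply/eqP; rewrite -(negbK (_ == _)) -has_filter; apply/hasPn=> x /kw.
by rewrite -leqNgt.
Qed.

Lemma below_large k w : {in w, forall x, x < k} -> below k w = w.
Proof. by move=> /allP/all_filterP. Qed.

(** Entering the minimum [o] from a nonempty [v] is a descent and leaving it is not, so the state
    after [o] matters only if nothing follows. *)
Lemma end_desc_min o v w : all (ltn o) v -> all (leq o) w ->
  end_desc false 0 (v ++ o :: w) =
    if nilp w then ~~ nilp v else end_desc false 0 w.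
Proof.
move=> ov ow; rewrite end_desc_cat /= end_desc_ge //.
case: v ov => [|x v] ov; first by rewrite ltn0.
by have /= -> := allP ov _ (mem_last x v).
Qed.

Lemma ddfree_min o v w : all (ltn o) v -> all (leq o) w ->
  ddfree false 0 (v ++ o :: w) =
    [&& ddfree false 0 v, ~~ end_desc false 0 v & ddfree false 0 w].
Proof.
move=> ov ow; rewrite ddfree_cat /= ddfree_ge //.
case: v ov => [|x v] ov //.
by have /= -> := allP ov _ (mem_last x v); rewrite andbT.
Qed.

Lemma last_ge c v : all (leq c) v -> c <= last c v.
Proof. by move=> cv; have /= := mem_last c v; rewrite inE => /predU1P[->|/(allP cv)]. Qed.

(** The passage from [c :: v] down to [w] is always a descent, so a one-letter [w] ends with one. *)
Lemma end_desc_split c v w : all (leq c) v -> all (gtn c) w ->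
  end_desc false 0 (c :: v ++ w) =
    if nilp w then end_desc false 0 v
    else (size w == 1) || end_desc false 0 w.
Proof.
move=> cv; rewrite /= end_desc_cat => wc.
have -> : end_desc false c v = end_desc false 0 v.
  by rewrite end_desc_ge //; case: (v).
case: w wc => [|x [|y w]] //= /andP[xc _].
by rewrite (leq_trans xc) // last_ge.
Qed.

Definition start_desc w := (1 < size w) && (nth 0 w 1 < nth 0 w 0).

(** Since the passage to a nonempty [w] is a descent, it creates a double descent exactly when a
    descent precedes it in [v] or follows it in [w]. *)
Lemma ddfree_split c v w : all (leq c) v -> all (gtn c) w ->
  ddfree false 0 (c :: v ++ w) =
    [&& ddfree false 0 v, ddfree false 0 w &
        nilp w || ~~ end_desc false 0 v && ~~ start_desc w].
Proof.
move=> cv; rewrite /= ddfree_cat ddfree_ge // => wc.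
have -> : end_desc false c v = end_desc false 0 v.
  by rewrite end_desc_ge //; case: (v).
congr andb; case: w wc => [|x w] //= /andP[xc _].
rewrite (leq_trans xc) ?last_ge // andbT; case: w => [|y w] /=.
  by rewrite andbT.
rewrite /start_desc /=; case: (y < x) => /=; first by rewrite !andbF.
by rewrite andbT andbC.
Qed.

(** * The simsun conditions as local conditions on trees *)

(* [noend t] (resp. [noendi t]) says that no restriction of [tword t] (resp.
   [tinv t]) to its small letters ends with a descent. *)
Fixpoint noend t :=
  if t is Nd A B then if tsize B == 0 then tsize A == 0 else noend B else true.

Fixpoint smn t :=
  if t is Nd A B then [&& smn A, noend A & smn B] else true.

Fixpoint noendi t :=
  if t is Nd A B then
    if tsize A == 0 then noendi B else (tsize A != 1) && noendi A
  else true.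

Definition startd t :=
  if t is Nd A B then (tsize B == 0) && (tsize A != 0) else false.

Fixpoint smni t :=
  if t is Nd A B then
    [&& smni B, smni A & (tsize A == 0) || noendi B && ~~ startd A]
  else true.

Lemma all_belowP (p : pred nat) k w :
  {in w, forall x, p x} -> all p (below k w).
Proof. by move=> pw; apply/allP => x; rewrite mem_below => /andP[_ /pw]. Qed.

(** Letters of [A] exceed those of [B], so a restriction can end at the root with part of [A] before
    it only when [B] is empty. *)
Lemma noendP t o :
  (forall k, ~~ end_desc false 0 (below k (tword t o))) <-> noend t.
Proof.
elim: t o => [|A _ B IB] o; first by split.
have E k : o < k -> end_desc false 0 (below k (tword (Nd A B) o)) =
    if nilp (below k (tword B o.+1)) then
      ~~ nilp (below k (tword A (o + (tsize B).+1)))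
    else end_desc false 0 (below k (tword B o.+1)).
  move=> ok; rewrite [tword _ _]/= below_cat /= ok end_desc_min //;
    apply: all_belowP => x; rewrite mem_tword => /andP[] /=; lia.
have E0 k : k <= o -> below k (tword (Nd A B) o) = [::].
  by move=> ko; apply: below_small => x; rewrite mem_tword => /andP[ox _]; lia.
split=> [H|].
  rewrite /=; case: eqP => B0.
    (* This threshold keeps every letter. *)
    have := H (o + tsize (Nd A B)); rewrite E; last by rewrite /=; lia.
    rewrite !below_large /nilp ?size_tword ?B0 ?negbK // => x;
      rewrite mem_tword => /andP[] /=; lia.
  apply/(IB o.+1) => k; case: (leqP k o) => ko.
    by rewrite below_small // => x; rewrite mem_tword => /andP[]; lia.
  have := H k; rewrite E //.
  by case: (below k _).
rewrite [noend _]/=; case: eqP => B0 H k; have [/E0-> //|ok] := leqP k o;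
  rewrite E //.
  case: B B0 {IB E E0} => //= _; case: A H => //.
(* An empty restriction of the nonempty [B] forces [k <= o.+1], so no letter of [A] survives
   either. *)
case: nilP => [B'|_]; last by have /(IB o.+1) := H.
have /below_small -> // : {in tword A (o + (tsize B).+1), forall x, k <= x}.
move=> x; rewrite mem_tword => /andP[ox _].
have : o.+1 \notin below k (tword B o.+1) by rewrite B'.
by rewrite mem_below mem_tword; lia.
Qed.

(** The root is a descent from whatever remains of [A], hence the demand that no restriction of [A]
    end with a descent. *)
Lemma smnP t o : (forall k, ddfree false 0 (below k (tword t o))) <-> smn t.
Proof.
elim: t o => [|A IA B IB] o; first by split.
have E k : o < k -> ddfree false 0 (below k (tword (Nd A B) o)) =
    let A' := below k (tword A (o + (tsize B).+1)) in
    [&& ddfree false 0 A', ~~ end_desc false 0 A' &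
        ddfree false 0 (below k (tword B o.+1))].
  move=> ok; rewrite [tword _ _]/= below_cat /= ok ddfree_min //;
    apply: all_belowP => x; rewrite mem_tword => /andP[] /=; lia.
have E0 k : k <= o -> [/\ below k (tword (Nd A B) o) = [::],
    below k (tword A (o + (tsize B).+1)) = [::] & below k (tword B o.+1) = [::]].
  by move=> ko; split; apply: below_small => x;
    rewrite mem_tword => /andP[ox _]; lia.
split=> [H|/and3P[/(IA (o + (tsize B).+1)) HA /(noendP _ (o + (tsize B).+1)) HE /(IB o.+1) HB] k].
  apply/and3P; split; [apply/(IA (o + (tsize B).+1))|
    apply/(noendP _ (o + (tsize B).+1))|apply/(IB o.+1)] => k;
    (have [/E0[_ EA EB]|ok] := leqP k o; first by rewrite ?EA ?EB);
    by have := H k; rewrite E // => /and3P[].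
by have [/E0[-> _ _] //|ok] := leqP k o; rewrite E //= HA HE HB.
Qed.

(** The second letter comes from [B], above the root, unless [B] is empty. *)
Lemma start_desc_tinv t o : start_desc (tinv t o) = startd t.
Proof.
case: t => // A [|B1 B2]; last by rewrite /start_desc /=; lia.
by case: A => // A1 A2; rewrite /start_desc /=; lia.
Qed.

(** Letters of [tinv A] lie below the root and those of [tinv B] above it, so a threshold truncates
    at most one of the two blocks. *)
Lemma below_tinv k A B o :
  below k (tinv (Nd A B) o) =
    if k <= o + tsize A then below k (tinv A o)
    else o + tsize A :: below k (tinv B (o + tsize A).+1) ++ tinv A o.
Proof.
rewrite /= ltnNge below_cat; case: leqP => ko /=.
  by rewrite below_small // => x; rewrite mem_tinv => /andP[]; lia.
by rewrite [below k (tinv A o)]below_large // => x; rewrite mem_tinv => /andP[]; lia.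
Qed.

Lemma all_tinv t o : all (gtn (o + tsize t)) (tinv t o).
Proof. by apply/allP => x; rewrite mem_tinv => /andP[]. Qed.

Lemma all_below_tinv k t o : all (leq o) (below k (tinv t o.+1)).
Proof. by apply: all_belowP => x; rewrite mem_tinv => /andP[/ltnW]. Qed.

Lemma noendiP t o :
  (forall k, ~~ end_desc false 0 (below k (tinv t o))) <-> noendi t.
Proof.
elim: t o => [|A IA B IB] o; first by split.
have E k : end_desc false 0 (below k (tinv (Nd A B) o)) =
    if k <= o + tsize A then end_desc false 0 (below k (tinv A o))
    else if tsize A == 0 then
      end_desc false 0 (below k (tinv B (o + tsize A).+1))
    else (tsize A == 1) || end_desc false 0 (tinv A o).
  rewrite below_tinv; case: leqP => // _.
  by rewrite end_desc_split ?all_below_tinv ?all_tinv // /nilp size_tinv.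
have large : below (o + tsize A) (tinv A o) = tinv A o.
  by apply: below_large => x; rewrite mem_tinv => /andP[].
rewrite [noendi _]/=; split=> [H|].
  case: eqP => A0.
    apply/(IB (o + tsize A).+1) => k; have := H k; rewrite E A0 /=.
    case: leqP => // ko _; rewrite below_small // => x.
    by rewrite mem_tinv => /andP[]; lia.
  (* The least threshold keeping the root leaves it followed by [A] alone; a single letter there
     would be a final descent. *)
  have := H (o + tsize A).+1; rewrite E ltnn (negPf (introN eqP A0)).
  rewrite negb_or => /andP[-> _]; apply/(IA o) => k; have := H k; rewrite E.
  case: leqP => // ko _; rewrite below_large.
    by have := H (o + tsize A); rewrite E leqnn large.
  by move=> x; rewrite mem_tinv => /andP[]; lia.
case: eqP => [A0 /(IB (o + tsize A).+1) HB|A0 /andP[A1 /(IA o) HA]] k.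
  rewrite E [tinv A o]size0nil ?size_tinv // (introT eqP A0).
  by case: ifP => // _; apply: HB.
rewrite E (negPf (introN eqP A0)) (negPf A1); case: ifP => // _.
by have := HA (o + tsize A); rewrite large.
Qed.

(** Once the root is kept, [tinv A] is present in full while [tinv B] may be cut anywhere: hence
    [startd] for [A] itself but [noendi] over all restrictions of [B]. *)
Lemma smniP t o : (forall k, ddfree false 0 (below k (tinv t o))) <-> smni t.
Proof.
elim: t o => [|A IA B IB] o; first by split.
have E k : ddfree false 0 (below k (tinv (Nd A B) o)) =
    if k <= o + tsize A then ddfree false 0 (below k (tinv A o))
    else let B' := below k (tinv B (o + tsize A).+1) in
      [&& ddfree false 0 B', ddfree false 0 (tinv A o) &
       (tsize A == 0) || ~~ end_desc false 0 B' && ~~ startd A].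
  rewrite below_tinv; case: leqP => // _.
  by rewrite ddfree_split ?all_below_tinv ?all_tinv // /nilp size_tinv start_desc_tinv.
have large k : o + tsize A <= k -> below k (tinv A o) = tinv A o.
  by move=> ko; apply: below_large => x; rewrite mem_tinv => /andP[]; lia.
have small k : k <= o + tsize A -> below k (tinv B (o + tsize A).+1) = [::].
  by move=> ko; apply: below_small => x; rewrite mem_tinv => /andP[]; lia.
split=> [H|/and3P[/(IB (o + tsize A).+1) HB /(IA o) HA HAB] k].
  apply/and3P; split.
  - apply/(IB (o + tsize A).+1) => k; have := H k; rewrite E.
    by case: leqP => [/small -> //|_ /and3P[]].
  - apply/(IA o) => k; have := H k; rewrite E.
    by case: leqP => // /ltnW/large -> /and3P[].
  have := H (o + tsize A).+1; rewrite E ltnn => /and3P[_ _].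
  case: eqP => //= A0 /andP[_ ->]; rewrite andbT.
  apply/(noendiP _ (o + tsize A).+1) => k; have := H k; rewrite E.
  case: leqP => [/small -> //|_ /and3P[_ _]].
  by rewrite (negPf (introN eqP A0)) => /andP[].
rewrite E; case: leqP => // ko; rewrite /= HB /= -{1}(large _ (leqnn _)) HA /=.
case/orP: HAB => [-> //|/andP[/(noendiP _ (o + tsize A).+1) HB' ->]].
by rewrite HB' orbT.
Qed.

(** * From permutations to words and trees *)

Lemma size_perm_word n (s : 'S_n) : size (perm_word s) = n.
Proof. by rewrite size_map size_enum_ord. Qed.

Lemma nth_perm_word n (s : 'S_n) (i : 'I_n) : nth 0 (perm_word s) i = s i.
Proof. by rewrite (nth_map i) ?size_enum_ord // nth_ord_enum. Qed.

Lemma perm_word_inj n : injective (@perm_word n).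
Proof.
move=> s s' E; apply/permP => i; apply: val_inj.
by rewrite /= -!nth_perm_word E.
Qed.

Lemma perm_perm_word n (s : 'S_n) : perm_eq (perm_word s) (iota 0 n).
Proof.
apply: uniq_perm; rewrite ?iota_uniq //.
  by rewrite map_inj_uniq ?enum_uniq // => i j /val_inj/perm_inj.
move=> x; rewrite mem_iota add0n leq0n /=; apply/mapP/idP => [[i _ ->]|xn]; first exact: ltn_ord.
by exists ((s^-1)%g (Ordinal xn)); rewrite ?mem_enum // permKV.
Qed.

Lemma perm_wordP n w : perm_eq w (iota 0 n) -> exists s : 'S_n, perm_word s = w.
Proof.
move=> wP; have szw : size w = n by rewrite (perm_size wP) size_iota.
have ltn (i : 'I_n) : nth 0 w i < n.
  have := mem_nth 0 (_ : i < size w); rewrite szw => /(_ (ltn_ord i)).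
  by rewrite (perm_mem wP) mem_iota => /andP[].
have f_inj : injective (fun i : 'I_n => Ordinal (ltn i)).
  move=> i j [] /eqP; rewrite nth_uniq ?szw //; last first.
    by rewrite (perm_uniq wP) iota_uniq.
  by move=> /eqP/val_inj.
exists (perm f_inj); apply: (@eq_from_nth _ 0); rewrite size_perm_word // => i lti.
by rewrite (nth_perm_word _ (Ordinal lti)) permE.
Qed.

Lemma perm_word_inv n (s : 'S_n) t :
  perm_word s = tword t 0 -> perm_word (s^-1)%g = tinv t 0.
Proof.
move=> st; have nE : tsize t = n by rewrite -(size_tword t 0) -st size_perm_word.
apply: (@eq_from_nth _ 0); rewrite size_perm_word ?size_tinv // => i lti.
rewrite (nth_perm_word _ (Ordinal lti)).
set j := (s^-1)%g _; have sj : s j = Ordinal lti by rewrite permKV.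
have := @nth_tinv_tword t 0 0 j; rewrite -st nE ltn_ord => /(_ isT).
by rewrite nth_perm_word sj subn0.
Qed.

Lemma simsunP n (s : 'S_n) :
  simsun s <-> forall k, ddfree false 0 (below k (perm_word s)).
Proof.
split=> [/forallP H k|H]; last by apply/forallP => k; rewrite -ddfreeE H.
have [kn|nk] := leqP k n; first by have := H (inord k); rewrite inordK // -ddfreeE.
have := H ord_max; rewrite -ddfreeE -!/(below _ _) => Hn.
have large m : n <= m -> below m (perm_word s) = perm_word s.
  move=> nm; apply: below_large => x.
  by rewrite (perm_mem (perm_perm_word s)) mem_iota /=; lia.
by rewrite large ?(ltnW nk) // -(large n).
Qed.

Lemma pat213E : [/\ pat213 (inord 0) = inord 1, pat213 (inord 1) = inord 0
  & pat213 (inord 2) = inord 2].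
Proof.
by split; rewrite /pat213 ?tpermL ?tpermR // tpermD //; apply/eqP => /(congr1 val);
  rewrite /= !inordK.
Qed.

(** Case analysis that keeps indices in the form [inord], in which the values of [pat213] are
    known. *)
Lemma ord3_ind (P : 'I_3 -> Prop) :
  P (inord 0) -> P (inord 1) -> P (inord 2) -> forall x, P x.
Proof. by move=> P0 P1 P2 x; rewrite -(inord_val x); case: x => -[|[|[|]]]. Qed.

Lemma avoids213 n (s : 'S_n) : avoids pat213 s = av213 (perm_word s).
Proof.
have [p0 p1 p2] := pat213E.
apply/idP/av213P => [av i j k ij jk|av].
  rewrite size_perm_word => kn; apply: contra av.
  have jn := ltn_trans jk kn; have i_n := ltn_trans ij jn.
  rewrite (nth_perm_word s (Ordinal i_n)) (nth_perm_word s (Ordinal jn))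
          (nth_perm_word s (Ordinal kn)) => /andP[ji ik].
  apply/existsP; exists [ffun x => tnth [tuple Ordinal i_n; Ordinal jn; Ordinal kn] x].
  apply/andP; split; apply/forallP; apply: ord3_ind; apply/forallP; apply: ord3_ind;
    rewrite ?p0 ?p1 ?p2 !ffunE !(tnth_nth (Ordinal i_n)) /= !inordK //=; lia.
apply/existsP => -[f /andP[/forallP inc /forallP pat]].
have lt01 := forallP (inc (inord 0)) (inord 1).
have lt12 := forallP (inc (inord 1)) (inord 2).
rewrite !inordK //= in lt01 lt12.
have := av _ _ _ lt01 lt12; rewrite size_perm_word ltn_ord !nth_perm_word => /(_ isT).
have := forallP (pat (inord 1)) (inord 0); have := forallP (pat (inord 0)) (inord 2).
by rewrite p0 p1 p2 !inordK // => /eqP -> /eqP ->.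
Qed.

Lemma mem_DRS213 n (s : 'S_n) t : perm_word s = tword t 0 ->
  (s \in DRS n pat213) = smn t && smni t.
Proof.
move=> st; rewrite inE avoids213 st av213_tword /=.
congr andb; apply/idP/idP => [/simsunP|H].
- by rewrite st => /smnP.
- by apply/simsunP; rewrite st; apply/smnP.
- by rewrite (perm_word_inv st) => /smniP.
by apply/simsunP; rewrite (perm_word_inv st); apply/smniP.
Qed.

(** * The grammar of Motzkin paths without consecutive up steps *)

Inductive upath := Nil | Flat of upath | Peak of upath | Arch of upath & upath.

Fixpoint psize p :=
  match p with
  | Nil => 0
  | Flat p => (psize p).+1
  | Peak p => (psize p).+2
  | Arch p q => (psize p + psize q).+3
  end.

(** An [Up] not followed at once by its matching [Down] must be followed by [Level], as a second
    [Up] is excluded; [Arch] therefore has a forced [Level]. *)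
Fixpoint steps p :=
  match p with
  | Nil => [::]
  | Flat p => Level :: steps p
  | Peak p => [:: Up, Down & steps p]
  | Arch p q => [:: Up, Level & steps p ++ Down :: steps q]
  end.

Lemma size_steps p : size (steps p) = psize p.
Proof.
elim: p => //= [p -> | p -> | p IHp q IHq] //.
by rewrite size_cat /= IHp IHq addnS.
Qed.

(* Reads a path from height [h]; [u] tells whether the last step was [Up]. *)
Fixpoint mot (u : bool) h s :=
  match s with
  | [::] => h == 0
  | Up :: s => ~~ u && mot true h.+1 s
  | Down :: s => if h is h'.+1 then mot false h' s else false
  | Level :: s => mot false h s
  end.

Lemma height_cons x s : height (x :: s) = (rise x + height s)%R.
Proof. by rewrite /height big_cons. Qed.

Lemma height_nil : height [::] = 0%R.
Proof. by rewrite /height big_nil. Qed.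

Lemma step_eqUp x : (Up == x) = if x is Up then true else false.
Proof. by apply/eqP/idP; case: x. Qed.

Lemma infixUU_cons (u : bool) x s :
  infix [:: Up; Up] (nseq u Up ++ x :: s) =
    (u && (Up == x)) || infix [:: Up; Up] (nseq (Up == x) Up ++ s).
Proof.
by have [<-|/negPf xU] := eqVneq Up x; case: u; rewrite /= ?eqxx ?xU ?prefix0s.
Qed.

Lemma motP u (h : nat) s :
  mot u h s <-> [/\ forall k, (0 <= h%:Z + height (take k s))%R,
                    (h%:Z + height s = 0)%R &
                    ~~ infix [:: Up; Up] (nseq u Up ++ s)].
Proof.
elim: s u h => [|x s IH] u h.
  split=> [/eqP -> | [_ + _]]; last by rewrite height_nil /=; lia.
  by split=> [[|k]||]; rewrite ?height_nil //; case: u; rewrite /= ?andbF.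
rewrite infixUU_cons height_cons.
have takeS : (forall k, 0 <= h%:Z + height (take k (x :: s)))%R <->
    (forall k, 0 <= h%:Z + (rise x + height (take k s)))%R.
  split=> [H k|H [|k]]; last by rewrite /= height_cons.
    by have := H k.+1; rewrite /= height_cons.
  by rewrite /= height_nil; lia.
suff: mot u h (x :: s) <->
    [/\ forall k, (0 <= h%:Z + (rise x + height (take k s)))%R,
        (h%:Z + (rise x + height s) = 0)%R &
        ~~ (u && (Up == x) || infix [:: Up; Up] (nseq (Up == x) Up ++ s))].
  by move=> ->; split=> -[/takeS H1 H2 H3].
rewrite step_eqUp; case: x {takeS} => /=.
- rewrite andbT negb_or.
  split=> [/andP[-> /IH[H1 H2 H3]]|[H1 H2 /andP[-> H3]] /=].
    by split=> [k||//]; [have := H1 k; lia|lia].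
  by apply/IH; split=> [k||//]; [have := H1 k; lia|lia].
- rewrite andbF; case: h => [|h]; last first.
    rewrite IH; split=> -[H1 H2 H3];
      by split=> [k||//]; [have := H1 k; lia|lia].
  by split=> // -[/(_ 0)]; rewrite take0 height_nil.
rewrite andbF IH; split=> -[H1 H2 H3];
  by split=> [k||//]; [have := H1 k; lia|lia].
Qed.

Lemma mem_motzkin_noUU n (p : n.-tuple step) : (p \in motzkin_noUU n) = mot false 0 p.
Proof.
rewrite inE; apply/andP/idP => [[/andP[/forallP H /eqP H0] UU]|/motP[H H0 UU]].
  apply/motP; split=> // [k|]; rewrite GRing.add0r //.
  have [kn|nk] := leqP k n; first by have := H (inord k); rewrite inordK.
  by have := H ord_max; rewrite !take_oversize ?size_tuple //= ltnW.
split=> //; apply/andP; split.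
  by apply/forallP => k; have := H k; rewrite GRing.add0r.
by move: H0; rewrite GRing.add0r => ->.
Qed.

Lemma mot_steps_cat p h s : mot false h (steps p ++ Down :: s) = mot false h (Down :: s).
Proof.
elim: p h s => //= p IHp q IHq h s.
by rewrite -catA cat_cons IHp IHq.
Qed.

Lemma mot_steps p : mot false 0 (steps p).
Proof. by elim: p => //= p _ q IHq; rewrite mot_steps_cat. Qed.

(** The prefix [steps p] is parsed up to the first step below the starting height. From height 0
    there is none; from a positive height it is a [Down]. Strong induction is needed since an arch
    parses twice, the second time after its closing [Down]. *)
Lemma mot_split h s : mot false h s -> exists p r, s = steps p ++ r /\
  if h is h'.+1 then exists2 r', r = Down :: r' & mot false h' r' else r = [::].
Proof.
have [m] := ubnP (size s); elim: m s h => // m IH [|x s] h; rewrite [_ < _]/= ltnS.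
  by move=> _ /eqP ->; exists Nil, [::].
case: x => sm /= hs.
- case: s sm hs => [|[] s] //= sm hs.
    by have [p [r [-> rP]]] := IH _ _ (ltnW sm) hs; exists (Peak p), r.
  have [p [r [sE [r' rE hr']]]] := IH _ _ (ltnW sm) hs.
  have [|q [r2 [r'E r2P]]] := IH _ _ _ hr'.
    by rewrite (leq_trans _ sm) // sE rE size_cat /=; lia.
  exists (Arch p q), r2; split=> //=.
  by rewrite sE rE r'E -catA.
- by case: h hs => // h hs; exists Nil, (Down :: s); split=> //; exists s.
by have [p [r [-> rP]]] := IH _ _ sm hs; exists (Flat p), r.
Qed.

(** A remainder is empty or starts with [Down], which no [steps p] does, so the end of a parsed
    block is unambiguous. The [Down] closing an arch gives its inner block such a remainder. *)
Lemma steps_cat_inj p q r r' :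
  (if r is x :: _ then x = Down else True) ->
  (if r' is x :: _ then x = Down else True) ->
  steps p ++ r = steps q ++ r' -> p = q /\ r = r'.
Proof.
move=> rP rP'.
elim: p q r r' rP rP' => [|p IH|p IH|p IHp p' IHp'] [|q|q|q q'] r r' rP rP' //=;
  try by [case: r rP => // x r -> | case: r' rP' => // x r' ->].
- by case=> /IH[] // -> ->.
- by case=> /IH[] // -> ->.
by case; rewrite -!catA => /IHp[] // -> [/IHp'[] // -> ->].
Qed.

Lemma steps_inj : injective steps.
Proof.
move=> p q E; have [//|//||//] := @steps_cat_inj p q [::] [::].
by rewrite !cats0.
Qed.

Lemma mot_stepsP s : mot false 0 s -> exists p, steps p = s.
Proof. by move/mot_split=> [p [_ [-> ->]]]; exists p; rewrite cats0. Qed.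

(** * Trees meeting both conditions, enumerated by the path grammar *)

(* [treeD] enumerates the trees satisfying [smn] and [smni]; [treeE] and [treeF]
   the nonempty ones that also satisfy [noend], resp. [noendi]; [treeH] those with
   at least two nodes that satisfy all four conditions.  The sizes exceed
   [psize p] by 0, 1, 1 and 2. *)
Fixpoint treeH p :=
  match p with
  | Nil => Nd Lf (Nd Lf Lf)
  | Flat p => Nd Lf (treeH p)
  | Peak p => Nd (treeH p) (Nd Lf Lf)
  | Arch p q => Nd (treeH p) (treeH q)
  end.

Fixpoint treeE p :=
  match p with
  | Nil => Nd Lf Lf
  | Flat p => Nd Lf (treeE p)
  | Peak p => Nd (treeE p) (Nd Lf Lf)
  | Arch p q => Nd (treeE p) (treeH q)
  end.

Fixpoint treeF p :=
  match p with
  | Nil => Nd Lf Lf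
  | Flat p => Nd Lf (treeF p)
  | Peak p => Nd (treeH p) Lf
  | Arch p q => Nd (treeH p) (treeF q)
  end.

Fixpoint treeD p :=
  match p with
  | Nil => Lf
  | Flat p => Nd Lf (treeD p)
  | Peak p => Nd (treeE p) Lf
  | Arch p q => Nd (treeE p) (treeF q)
  end.

Lemma tsize_treeH p : tsize (treeH p) = (psize p).+2.
Proof. by elim: p => //= [p -> | p -> | p -> q ->]; lia. Qed.

Lemma tsize_treeE p : tsize (treeE p) = (psize p).+1.
Proof. by elim: p => //= [p -> | p -> | p -> q _]; rewrite ?tsize_treeH; lia. Qed.

Lemma tsize_treeF p : tsize (treeF p) = (psize p).+1.
Proof. by elim: p => //= [p -> | p _ | p _ q ->]; rewrite ?tsize_treeH; lia. Qed.

Lemma tsize_treeD p : tsize (treeD p) = psize p.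
Proof.
by elim: p => //= [p -> | p _ | p _ q _] //; rewrite tsize_treeE ?tsize_treeF; lia.
Qed.

(** [smn] of a node already demands [noend] of its left subtree, so the [startd] clause of [smni]
    follows. *)
Lemma noend_startd t : noend t -> ~~ startd t.
Proof. by case: t => //= A B; case: eqP => //= _ ->. Qed.

Lemma treeH_ok p :
  [&& smn (treeH p), noend (treeH p), smni (treeH p) & noendi (treeH p)].
Proof.
elim: p => //= [p|p|p + q]; rewrite ?tsize_treeH /=.
- by rewrite andbT.
- by case/and4P=> -> H2 -> ->; rewrite H2 noend_startd.
by case/and4P=> -> H2 -> -> /and4P[-> -> -> ->]; rewrite H2 noend_startd.
Qed.

Lemma treeE_ok p : [&& smn (treeE p), noend (treeE p) & smni (treeE p)].
Proof.
elim: p => //= [p|p|p + q _]; rewrite ?tsize_treeE ?tsize_treeH /=.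
- by rewrite andbT.
- by case/and3P=> -> H2 ->; rewrite H2 noend_startd.
by have /and4P[-> -> -> ->] := treeH_ok q; case/and3P=> -> H2 ->; rewrite H2 noend_startd.
Qed.

Lemma treeF_ok p : [&& smn (treeF p), smni (treeF p) & noendi (treeF p)].
Proof.
elim: p => //= [p|p _|p _ q]; rewrite ?tsize_treeH /=.
- by rewrite andbT.
- by have /and4P[-> H2 -> ->] := treeH_ok p; rewrite H2 noend_startd.
by have /and4P[-> H2 -> ->] := treeH_ok p; case/and3P=> -> -> ->; rewrite H2 noend_startd.
Qed.

Lemma treeD_ok p : smn (treeD p) && smni (treeD p).
Proof.
elim: p => //= [p|p _|p _ q _]; rewrite ?tsize_treeE /=.
- by rewrite andbT.
- by have /and3P[-> H2 ->] := treeE_ok p; rewrite H2 noend_startd.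
have /and3P[-> H2 ->] := treeE_ok p; have /and3P[-> -> ->] := treeF_ok q.
by rewrite H2 noend_startd.
Qed.

(** Different constructors are told apart by sizes: the left subtree is empty or has at least two
    nodes, the right one has exactly one or at least two. *)
Lemma treeH_inj : injective treeH.
Proof.
elim=> [|p IH|p IH|p IHp q IHq] [|p'|p'|p' q'] //= [];
  by [move/IH-> | move=> /IHp-> /IHq->
      | move=> /(congr1 tsize)/= + /(congr1 tsize)/=; rewrite ?tsize_treeH; lia
      | move/(congr1 tsize)=> /=; rewrite ?tsize_treeH; lia].
Qed.

Lemma treeE_inj : injective treeE.
Proof.
elim=> [|p IH|p IH|p IHp q IHq] [|p'|p'|p' q'] //= [];
  by [move/IH-> | move=> /IHp-> /treeH_inj->
      | move=> /(congr1 tsize)/= + /(congr1 tsize)/=; rewrite ?tsize_treeE ?tsize_treeH; lia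
      | move/(congr1 tsize)=> /=; rewrite ?tsize_treeE ?tsize_treeH; lia].
Qed.

Lemma treeF_inj : injective treeF.
Proof.
elim=> [|p IH|p IH|p IHp q IHq] [|p'|p'|p' q'] //= [];
  by [move/IH-> | move/treeH_inj-> | move=> /treeH_inj-> /IHq->
      | move=> /(congr1 tsize)/= + /(congr1 tsize)/=; rewrite ?tsize_treeF ?tsize_treeH; lia
      | move/(congr1 tsize)=> /=; rewrite ?tsize_treeF ?tsize_treeH; lia].
Qed.

Lemma treeD_inj : injective treeD.
Proof.
elim=> [|p IH|p IH|p IHp q IHq] [|p'|p'|p' q'] //= [];
  by [move/IH-> | move/treeE_inj-> | move=> /treeE_inj-> /treeF_inj->
      | move=> /(congr1 tsize)/= + /(congr1 tsize)/=; rewrite ?tsize_treeE ?tsize_treeF; lia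
      | move/(congr1 tsize)=> /=; rewrite ?tsize_treeE ?tsize_treeF; lia].
Qed.

Lemma tsize0 t : tsize t = 0 -> t = Lf.
Proof. by case: t. Qed.

Lemma tsize1 t : tsize t = 1 -> t = Nd Lf Lf.
Proof. by case: t => //= -[|? ?] [|? ?] //= [] /eqP; rewrite ?addnS. Qed.

(** With at least two nodes, [noend] makes [B] nonempty and [noendi] forbids a one-node [A].
    Nonempty subtrees inherit all four conditions, so [A] is empty or of type [treeH], [B] a single
    node or of type [treeH]: four cases for four constructors. *)
Lemma treeHP t : [&& smn t, noend t, smni t & noendi t] -> 1 < tsize t ->
  exists p, treeH p = t.
Proof.
elim: t => //= A IA B IB /and4P[/and3P[sA eA sB]].
case: eqP => [-> /eqP -> //|B0 eB /and3P[siB siA]].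
case: (posnP (tsize A)) => [/tsize0 -> _ eiB _|A0 /= /andP[eiB _] /andP[A1 eiA] _].
  have [/tsize1 ->|B1] := eqVneq (tsize B) 1; first by exists Nil.
  have [||p <-] := IB; [by rewrite sB eB siB|lia|by exists (Flat p)].
have [||p <-] := IA; [by rewrite sA eA siA|lia|].
have [/tsize1 ->|B1] := eqVneq (tsize B) 1; first by exists (Peak p).
have [||q <-] := IB; [by rewrite sB eB siB|lia|by exists (Arch p q)].
Qed.

(** Without [noendi], a nonempty [A] is only of type [treeE]; but then [smni] imposes [noendi] on
    [B], which is a single node or of type [treeH]. *)
Lemma treeEP t : [&& smn t, noend t & smni t] -> 0 < tsize t ->
  exists p, treeE p = t.
Proof.
elim: t => //= A IA B IB /and3P[/and3P[sA eA sB]].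
case: eqP => [/tsize0 -> /eqP/tsize0 -> _ _|B0 eB /and3P[siB siA]]; first by exists Nil.
case: (posnP (tsize A)) => [/tsize0 -> _ _|A0 /= /andP[eiB _] _].
  have [||p <-] := IB; [by rewrite sB eB siB|lia|by exists (Flat p)].
have [||p <-] := IA; [by rewrite sA eA siA|lia|].
have [/tsize1 ->|B1] := eqVneq (tsize B) 1; first by exists (Peak p).
have [||q <-] := @treeHP B; [by rewrite sB eB siB|lia|by exists (Arch p q)].
Qed.

(** Without [noend], [B] may be empty; otherwise it is of type [treeF]. A nonempty [A] still gets
    [noend] from [smn], hence is of type [treeH]. *)
Lemma treeFP t : [&& smn t, smni t & noendi t] -> 0 < tsize t ->
  exists p, treeF p = t.
Proof.
elim: t => //= A _ B IB /and3P[/and3P[sA eA sB] /and3P[siB siA]].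
case: (posnP (tsize A)) => [/tsize0 -> _ eiB _|A0 /= /andP[eiB _] /andP[A1 eiA] _].
  have [/tsize0 ->|B0] := posnP (tsize B); first by exists Nil.
  have [||p <-] := IB; [by rewrite sB siB|lia|by exists (Flat p)].
have [||p <-] := @treeHP A; [by rewrite sA eA siA|lia|].
have [/tsize0 ->|B0] := posnP (tsize B); first by exists (Peak p).
have [||q <-] := IB; [by rewrite sB siB|lia|by exists (Arch p q)].
Qed.

(** A nonempty [A] is of type [treeE] and forces [noendi] on [B], which is then empty or of type
    [treeF]; an empty [A] leaves [B] of type [treeD]. *)
Lemma treeDP t : smn t && smni t -> exists p, treeD p = t.
Proof.
elim: t => [|A _ B IB] /=; first by exists Nil.
case/andP=> /and3P[sA eA sB] /and3P[siB siA].
case: (posnP (tsize A)) => [/tsize0 -> _|A0 /= /andP[eiB _]].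
  by have [|p <-] := IB; [rewrite sB siB|exists (Flat p)].
have [||p <-] := @treeEP A; [by rewrite sA eA siA|lia|].
have [/tsize0 ->|B0] := posnP (tsize B); first by exists (Peak p).
have [||q <-] := @treeFP B; [by rewrite sB siB|lia|by exists (Arch p q)].
Qed.

(** * Comparison of cardinalities *)

(** Working with a relation avoids computing the tree of a permutation or the parse of a path:
    existence and injectivity suffice. *)
Lemma leq_card_rel (T U : finType) (A : {set T}) (B : {set U}) (r : T -> U -> Prop) :
  (forall x, x \in A -> exists2 y, y \in B & r x y) ->
  (forall x x' y, r x y -> r x' y -> x = x') ->
  #|A| <= #|B|.
Proof.
move=> rT r_inj.
(* The finite choice principle needs a value at every [x]; [None] serves outside [A], as [U] may be
   empty. *)
have [f fP] : exists f : T -> option U, forall x, x \in A ->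
    exists y, [/\ f x = Some y, y \in B & r x y].
  apply: (@fin_all_exists T (fun=> option U)
    (fun x z => x \in A -> exists y, [/\ z = Some y, y \in B & r x y])) => x.
  have [/rT[y yB rxy]|xA] := boolP (x \in A); last by exists None.
  by exists (Some y) => _; exists y.
rewrite -(card_imset (mem B) (@Some_inj _ : injective (@Some U))).
have f_inj : {in A &, injective f}.
  move=> x x' /fP[y [-> _ rxy]] /fP[y' [-> _ rxy']] [yy'].
  by apply: r_inj rxy _; rewrite yy'.
rewrite -(card_in_imset f_inj); apply/subset_leq_card/subsetP => z.
case/imsetP=> x /fP[y [-> yB _]] ->; exact: imset_f.
Qed.

Theorem theorem3p3 (n : nat) (hn : 1 <= n) :
  #|DRS n pat213| = secondary_structure_number n.
Proof.
(* A permutation and a path correspond when one [upath] yields both; the two inequalities use [r] in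
   its two directions. *)
pose r (s : 'S_n) (p : n.-tuple step) :=
  exists2 q, perm_word s = tword (treeD q) 0 & val p = steps q.
apply/eqP; rewrite eqn_leq; apply/andP; split.
  apply: (@leq_card_rel _ _ _ _ r) => [s sD|s s' p [q sq pq] [q' sq' pq']].
    have av : av213 (perm_word s).
      by rewrite -avoids213; move: sD; rewrite inE => /and3P[].
    have [t tn st] := av213_treeP (perm_perm_word s) av.
    move: sD; rewrite (mem_DRS213 (esym st)) => /treeDP[q qt].
    have sz : size (steps q) == n by rewrite size_steps -tsize_treeD qt tn.
    exists (Tuple sz); first by rewrite mem_motzkin_noUU mot_steps.
    by exists q; rewrite ?qt.
  by apply: perm_word_inj; rewrite sq sq' (steps_inj (etrans (esym pq) pq')).
apply: (@leq_card_rel _ _ _ _ (fun p s => r s p)) => [p|p p' s [q sq pq] [q' sq' pq']].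
  rewrite mem_motzkin_noUU => /mot_stepsP[q qp].
  have qn : tsize (treeD q) = n by rewrite tsize_treeD -size_steps qp size_tuple.
  have [|s sq] := @perm_wordP n (tword (treeD q) 0); first by rewrite -qn perm_tword.
  by exists s; [rewrite (mem_DRS213 sq) treeD_ok | exists q].
apply: val_inj; rewrite /= pq pq'.
by rewrite (treeD_inj (tword_inj (etrans (esym sq) sq'))).
Qed.
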